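(* There is a universal constant $C>0$ such that the following holds. Let $\lambda=\tau-2\ge1$, fix $0<\zeta\le 0.99\lambda$ and $0<\beta<\tfrac12$, and let $\gamma=\frac1K\left(\frac{\beta^{1/\lambda}}{2^{K/\lambda}}\right)^{C}$. Let $G$ be a random factor graph with $n$ variable-vertices and $m=\Delta n$ constraint-vertices. If $\mathrm{SMALL}\le\gamma\cdot\frac{n}{\Delta^{2/(\lambda-\zeta)}}$, then except with probability at most $\beta$, $G$ satisfies the Plausibility Assumption. Moreover, assuming $\zeta<1$, except with probability at most $\beta$, \[ \#\{\text{nonempty }\tau\text{-subgraphs }H\text{ of }G\text{ with }|\mathrm{cons}(H)|\le2\cdot\mathrm{SMALL}\text{ and }I(H)\le\tau-1\}\le\Delta n^{\frac{1+\zeta}2}. \]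
   Context: Fix integers $K\ge3$ and $3\le\tau\le K$. A random factor graph with $n$ variable-vertices and $m$ constraint-vertices is a bipartite graph in which each constraint-vertex $f$, independently, is joined to a uniformly random ordered list $N(f)$ of distinct variable-vertices, of arity between $\tau-1$ and $K$. A subgraph of $G$ is an edge-induced subgraph $H=G[A]$ for a set $A$ of edges (possibly empty, not necessarily connected); $\mathrm{vbls}(H),\mathrm{cons}(H)$ denote its variable- and constraint-vertices and $N_H(f)$ the variables adjacent to $f$ in $H$. $H$ is a $\tau$-subgraph if $|N_H(f)|\ge\tau$ for all $f\in\mathrm{cons}(H)$. A leaf is a variable-vertex of degree $1$ in $H$. For a $\tau$-subgraph $H$: credits $=$ number of leaves; debits $=\sum_{i\in\mathrm{vbls}(H)}\max(\deg_H(i)-2,0)+\sum_{f\in\mathrm{cons}(H)}(|N_H(f)|-\tau)$; revenue $R(H)=$ credits $-$ debits; income $I(H)=R(H)-\zeta|\mathrm{cons}(H)|$; $H$ is plausible if $I(H)\ge0$. $\mathrm{SMALL}\ge1$ is a parameter. The Plausibility Assumption states that every $\tau$-subgraph $H$ of $G$ with $|\mathrm{cons}(H)|\le2\cdot\mathrm{SMALL}$ is plausible. *)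

(* Defs.v *)
From mathcomp Require Import all_boot all_order all_algebra.
From mathcomp Require Import reals exp.

Set Implicit Arguments.
Unset Strict Implicit.
Unset Printing Implicit Defensive.

Import Order.TTheory GRing.Theory Num.Theory.

Local Open Scope ring_scope.

(** Variable-vertices are ['I_n], constraint-vertices are ['I_m]; the constraint
    [f] has a prescribed arity [ar f]. *)

Definition scope (n a : nat) := {t : a.-tuple 'I_n | uniq t}.

Definition factor_graph (n m : nat) (ar : 'I_m -> nat) :=
  {dffun forall f : 'I_m, scope n (ar f)}.

(** Drawing the lists [N(f)] independently, each one uniformly among the lists
    of [ar f] distinct variable-vertices, is the uniform distribution on the
    finite product [factor_graph n ar].  The product is empty, and [Pr] is then
    [0], when some [ar f] exceeds [n]. *)
Definition Pr (R : realType) (n m : nat) (ar : 'I_m -> nat)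
    (E : pred (factor_graph n ar)) : R :=
  #|[set G : factor_graph n ar | E G]|%:R / #|{: factor_graph n ar}|%:R.

Arguments Pr R {n m} ar E.

Section Subgraphs.

Variables n m : nat.

(** The subgraph [G[A]] induced by a set of edges of [G] is represented by the
    set [A] itself. *)
Implicit Type A : {set 'I_m * 'I_n}.

Definition edges (ar : 'I_m -> nat) (G : factor_graph n ar) :
    {set 'I_m * 'I_n} :=
  [set e | e.2 \in val (G e.1)].

Definition cons_of A : {set 'I_m} := [set e.1 | e in A].

Definition vbls A : {set 'I_n} := [set e.2 | e in A].

Definition nbrs A (f : 'I_m) : {set 'I_n} := [set i | (f, i) \in A].

Definition deg A (i : 'I_n) : nat := #|[set f | (f, i) \in A]|.

Definition tau_subgraph (tau : nat) (ar : 'I_m -> nat) (G : factor_graph n ar)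
    A : bool :=
  (A \subset edges G) && [forall f in cons_of A, (tau <= #|nbrs A f|)%N].

Definition leaves A : {set 'I_n} := [set i in vbls A | deg A i == 1%N].

Definition credits A : int := #|leaves A|%:Z.

Definition debits (tau : nat) A : int :=
  \sum_(i in vbls A) Num.max ((deg A i)%:Z - 2) 0
  + \sum_(f in cons_of A) (#|nbrs A f|%:Z - tau%:Z).

Definition revenue (tau : nat) A : int := credits A - debits tau A.

Definition income (R : realType) (tau : nat) (zeta : R) A : R :=
  (revenue tau A)%:~R - zeta * #|cons_of A|%:R.

Definition plausible (R : realType) (tau : nat) (zeta : R) A : bool :=
  0 <= income tau zeta A.

Definition plausibility_assumption (R : realType) (tau : nat) (zeta SMALL : R)
    (ar : 'I_m -> nat) (G : factor_graph n ar) : bool :=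
  [forall A : {set 'I_m * 'I_n},
    tau_subgraph tau G A && (#|cons_of A|%:R <= 2 * SMALL)
      ==> plausible tau zeta A].

Definition low_income_subgraphs (R : realType) (tau : nat) (zeta SMALL : R)
    (ar : 'I_m -> nat) (G : factor_graph n ar) : {set {set 'I_m * 'I_n}} :=
  [set A : {set 'I_m * 'I_n} |
    [&& A != set0, tau_subgraph tau G A, #|cons_of A|%:R <= 2 * SMALL
      & income tau zeta A <= tau%:R - 1]].

End Subgraphs.

Definition gamma (R : realType) (K : nat) (lambda beta C : R) : R :=
  1 / K%:R * (beta `^ (1 / lambda) / 2 `^ (K%:R / lambda)) `^ C.

(* Main.v *)
Require Import Defs.
From mathcomp Require Import all_boot all_order all_algebra.
From mathcomp Require Import perm reals sequences exp.
From mathcomp Require Import zify ring lra.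

Set Implicit Arguments.
Unset Strict Implicit.
Unset Printing Implicit Defensive.

Import Order.TTheory GRing.Theory Num.Theory.

Local Open Scope ring_scope.

(** First moment method.  Summing [deg - 2] over the variables gives the identity
    revenue = 2 |vbls| + tau |cons| - 2 |A|, so an implausible (or low-income)
    subgraph with [c] constraints is a set of edges [A] with
    |A| >= |vbls| + x(c), for an explicit excess x(c).  A fixed [A] is contained
    in [G] with probability at most (K/n)^|A|, and the sum of these weights over
    the edge sets with [c] constraints and excess [x] is at most
    e^((3K+1)c) (m/c)^c (Kc/n)^x.  For c <= 2 SMALL the definition of gamma
    makes Delta (Kc/n)^((lambda-zeta)/2) smaller than (beta/2^K)^30 2^K, and
    these terms are dominated by a geometric series. *)

(** * Counting identities for edge sets *)

Section EdgeSets.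

Variables n m : nat.
Implicit Type A : {set 'I_m * 'I_n}.

Lemma sum_card_nbrs A : (\sum_(f in cons_of A) #|nbrs A f|)%N = #|A|.
Proof.
rewrite -sum1_card (partition_big (fun e => e.1) (mem (cons_of A))) /=; last first.
  by move=> e eA; apply: imset_f.
apply: eq_bigr => f _; rewrite sum1_card.
rewrite -(card_imset (nbrs A f) (f := fun i => (f, i))); last by move=> i j [].
apply: eq_card => -[g i]; rewrite unfold_in /=; apply/imsetP/andP => /=.
  by case=> j; rewrite inE => jA [-> ->].
by case=> gA /eqP<-; exists i; rewrite ?inE.
Qed.

Lemma sum_deg A : (\sum_(i in vbls A) deg A i)%N = #|A|.
Proof.
rewrite -sum1_card (partition_big (fun e => e.2) (mem (vbls A))) /=; last first.
  by move=> e eA; apply: imset_f.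
apply: eq_bigr => i _; rewrite sum1_card /deg.
rewrite -(card_imset [set f | (f, i) \in A] (f := fun f => (f, i))); last by move=> f g [].
apply: eq_card => -[f j]; rewrite unfold_in /=; apply/imsetP/andP => /=.
  by case=> g; rewrite inE => gA [-> ->].
by case=> fA /eqP<-; exists f; rewrite ?inE.
Qed.

Lemma deg_gt0 A i : i \in vbls A -> (0 < deg A i)%N.
Proof.
by case/imsetP=> -[f j] fA /= ->; apply/card_gt0P; exists f; rewrite inE.
Qed.

Lemma revenueE tau A :
  revenue tau A = (2 * #|vbls A| + tau * #|cons_of A|)%N%:Z - (2 * #|A|)%N%:Z.
Proof.
have Posz_sum := big_morph Posz PoszD (erefl 0).
have leavesE : #|leaves A|%:Z = \sum_(i in vbls A) (deg A i == 1%N)%:Z.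
  rewrite -sum1_card Posz_sum big_mkcond [RHS]big_mkcond /=.
  by apply: eq_bigr => i _; rewrite inE; case: (i \in vbls A); case: (deg A i == 1%N).
(* Every variable of the subgraph has degree d >= 1, and then [d = 1] - max(d - 2, 0) = 2 - d, so
   leaves and excess degrees merge into one linear expression. *)
have degE : #|leaves A|%:Z - \sum_(i in vbls A) Num.max ((deg A i)%:Z - 2) 0
    = 2 * #|vbls A|%:Z - #|A|%:Z.
  rewrite leavesE -sum_deg -sum1_card !Posz_sum mulr_sumr -!sumrB.
  by apply: eq_bigr => i /deg_gt0; move: (deg A i) => d d0; case: eqP => d1 /=; lia.
have nbrsE : \sum_(f in cons_of A) (#|nbrs A f|%:Z - tau%:Z)
    = #|A|%:Z - tau%:Z * #|cons_of A|%:Z.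
  by rewrite sumrB sumr_const -sum_card_nbrs Posz_sum -mulr_natr natz.
rewrite /revenue /credits /debits nbrsE opprD addrA degE; lia.
Qed.

Lemma card_vbls_le A : (#|vbls A| <= #|A|)%N.
Proof. exact: leq_imset_card. Qed.

(** A subgraph with a single constraint is a star. This gives its income exactly, and so excludes it
    from the low-income count. *)
Lemma card_vbls_cons1 A : #|cons_of A| = 1%N -> #|vbls A| = #|A|.
Proof.
move/eqP/cards1P=> [f Af]; apply: card_in_imset => -[g i] [h j] gA hA /= ij.
have : g \in cons_of A by apply/imsetP; exists (g, i).
have : h \in cons_of A by apply/imsetP; exists (h, j).
by rewrite Af !inE ij => /eqP-> /eqP->.
Qed.

Lemma cons_of_eq0 A : (#|cons_of A| == 0%N) = (A == set0).
Proof. by rewrite cards_eq0 imset_eq0. Qed.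

Lemma sub_cons_vbls A : A \subset setX (cons_of A) (vbls A).
Proof.
by apply/subsetP=> -[f i] fiA; rewrite !inE !imset_f.
Qed.

End EdgeSets.

(** * Probability that a fixed edge set lies in the random graph *)

Section Containment.

Variables (n m : nat) (ar : 'I_m -> nat).
Implicit Types (A : {set 'I_m * 'I_n}) (G : factor_graph n ar).

Definition containing A : {set factor_graph n ar} := [set G | A \subset edges G].

Definition perm_scope a (s : {perm 'I_n}) (t : scope n a) : scope n a :=
  Sub (map_tuple s (val t)) (etrans (map_inj_uniq perm_inj _) (valP t)).

Definition swap_at (f : 'I_m) (x y : 'I_n) G : factor_graph n ar :=
  [ffun g => if g == f then perm_scope (tperm x y) (G g) else G g].

Lemma in_edges_swap_at f x y G e :
  (e \in edges (swap_at f x y G)) =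
  ((e.1, if e.1 == f then tperm x y e.2 else e.2) \in edges G).
Proof.
rewrite !inE ffunE /=; case: ifP => // _.
by rewrite /= -[X in X \in map _ _](tpermK x y) (mem_map perm_inj).
Qed.

Lemma swap_at_inj f x y : injective (swap_at f x y).
Proof.
apply: (can_inj (g := swap_at f x y)) => G; apply/ffunP=> g; rewrite !ffunE.
case: ifP => [gf|->//]; do 2 apply: val_inj; rewrite /= gf /= -map_comp.
by rewrite -[RHS]map_id; apply: eq_map => z /=; rewrite tpermK.
Qed.

(** Exchanging [x] and [y] in the list of [f] alone is injective on factor graphs. It preserves the
    edges of [A], which involve neither (f, x) nor (f, y), and turns the edge (f, x) into (f, y). *)
Lemma card_containing_swap A f x y :
    (f, x) \notin A -> (f, y) \notin A ->
  (#|containing ((f, x) |: A)| <= #|containing ((f, y) |: A)|)%N.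
Proof.
move=> xA yA; rewrite -(card_imset _ (@swap_at_inj f x y)).
apply/subset_leq_card/subsetP=> _ /imsetP[G + ->]; rewrite !inE !subUset !sub1set.
case/andP=> xG AG; rewrite in_edges_swap_at /= eqxx tpermR xG /=.
apply/subsetP=> -[g z] gzA; rewrite in_edges_swap_at /=.
have := subsetP AG _ gzA; case: eqP => // gf.
rewrite gf in gzA *; rewrite tpermD //; first by apply: contraNneq xA => ->.
by apply: contraNneq yA => ->.
Qed.

Lemma card_nbrs_edges G f : #|nbrs (edges G) f| = ar f.
Proof.
have -> : nbrs (edges G) f = [set i in val (val (G f))].
  by apply/setP=> i; rewrite !inE.
by rewrite cardsE; move/card_uniqP: (valP (G f)) => ->; rewrite size_tuple.
Qed.

(** Double counting of pairs (G, y): once [G] contains [A], exactly [ar f] minus #|nbrs A f| entries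
    of the list of [f] give a new edge. *)
Lemma sum_card_containing A f :
  (\sum_(y | (f, y) \notin A) #|containing ((f, y) |: A)| =
   #|containing A| * (ar f - #|nbrs A f|))%N.
Proof.
under eq_bigr => y _ do rewrite -sum1_card big_mkcond.
rewrite exchange_big /= -sum_nat_const [RHS]big_mkcond; apply: eq_bigr => G _.
case: ifPn => [|GA]; last first.
  apply: big1 => y _; rewrite inE subUset; case: ifP => // /andP[_ AG].
  by rewrite inE AG in GA.
rewrite inE => AG; rewrite -big_mkcondr sum1_card.
have sAG : nbrs A f \subset nbrs (edges G) f.
  by apply/subsetP=> i; rewrite !inE => /(subsetP AG); rewrite inE.
rewrite -(card_nbrs_edges G) -(setIidPr sAG) -cardsD.
by apply: eq_card => y; rewrite [LHS]unfold_in /= !inE subUset AG andbT sub1set !inE.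
Qed.

(** With k neighbours of f already used, symmetry among the n - k remaining variables makes the
    conditional probability of one more edge at most (ar f - k) / (n - k). This is at most ar f / n
    <= K / n because ar f <= n, which holds as soon as one factor graph exists. *)
Lemma card_containing_setU1 A e (K : nat) :
    e \notin A -> (ar e.1 <= K)%N ->
  (n * #|containing (e |: A)| <= K * #|containing A|)%N.
Proof.
case: e => f x /= xA arK; have [->|/set0Pn[G]] := eqVneq (containing ((f, x) |: A)) set0.
  by rewrite cards0 muln0.
rewrite inE => AG.
have ar_le : (ar f <= n)%N.
  by rewrite -(card_nbrs_edges G); apply: leq_trans (max_card _) _; rewrite card_ord.
have nbrsC : #|[pred y | (f, y) \notin A]| = (n - #|nbrs A f|)%N.
  have -> : #|[pred y | (f, y) \notin A]| = #|~: nbrs A f|.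
    by apply: eq_card => y; rewrite !inE.
  by have := cardsC (nbrs A f); rewrite card_ord; lia.
have nk : (#|nbrs A f| < n)%N.
  by rewrite -subn_gt0 -nbrsC; apply/card_gt0P; exists x.
have : ((n - #|nbrs A f|) * #|containing ((f, x) |: A)| <=
        #|containing A| * (ar f - #|nbrs A f|))%N.
  rewrite -sum_card_containing -nbrsC -sum_nat_const.
  by apply: leq_sum => y yA; apply: card_containing_swap.
move: (#|containing A|) (#|containing _|) (#|nbrs A f|) nk => N N' k nk le1.
rewrite -(leq_pmul2l (m := n - k)); last by rewrite subn_gt0.
apply: (leq_trans (n := n * (N * (ar f - k)))); first by rewrite mulnCA leq_mul2l le1 orbT.
have -> : (n * (N * (ar f - k)) = N * (n * (ar f - k)))%N by rewrite mulnCA.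
have -> : ((n - k) * (K * N) = N * (K * (n - k)))%N by rewrite mulnA mulnC (mulnC K).
rewrite leq_mul2l; apply/orP; right.
apply: (leq_trans (n := ar f * (n - k))); last by rewrite leq_mul2r arK orbT.
by rewrite !mulnBr (mulnC n (ar f)) leq_sub2l // leq_mul2r ar_le orbT.
Qed.

Lemma card_containing A (K : nat) :
    (forall f, (ar f <= K)%N) ->
  (n ^ #|A| * #|containing A| <= K ^ #|A| * #|{: factor_graph n ar}|)%N.
Proof.
move=> arK; move: {2}#|A| (erefl #|A|) => k.
elim: k A => [|k IH] A cardA; rewrite cardA.
  by rewrite !expn0 !mul1n max_card.
have [e eA] : exists e, e \in A by apply/card_gt0P; rewrite cardA.
have := cardsD1 e A; rewrite eA cardA add1n => -[/esym cardA'].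
have := @card_containing_setU1 (A :\ e) e K _ (arK _).
rewrite setD1K // setD11 => /(_ isT) le1.
rewrite expnSr -mulnA expnS; apply: leq_trans (leq_mul (leqnn _) le1) _.
by rewrite mulnCA -mulnA leq_mul2l -{1 2}cardA' IH ?orbT.
Qed.

Lemma card_le_mul_cons A G (K : nat) :
    (forall f, (ar f <= K)%N) -> A \subset edges G ->
  (#|A| <= K * #|cons_of A|)%N.
Proof.
move=> arK AG; rewrite -sum_card_nbrs mulnC -sum_nat_const.
apply: leq_sum => f _; apply: leq_trans (arK f); rewrite -(card_nbrs_edges G).
by apply/subset_leq_card/subsetP=> i; rewrite !inE => /(subsetP AG); rewrite inE.
Qed.

End Containment.

(** * Weighted sums over edge sets and the first moment bound *)

Lemma sum_expr_card_subset (R : comNzRingType) (T : finType) (X : {set T}) (z : R) :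
  \sum_(A : {set T} | A \subset X) z ^+ #|A| = (1 + z) ^+ #|X|.
Proof.
have -> : (1 + z) ^+ #|X| = \prod_i ((if i \in X then z else 0) + 1).
  rewrite -prodr_const [LHS]big_mkcond; apply: eq_bigr => i _.
  by case: ifP => _; rewrite ?add0r // addrC.
(* Expanding the product gives a sum over all subsets; a subset not inside [X] picks up a zero
   factor. *)
rewrite bigA_distr big_mkcond; apply: eq_bigr => A _ /=; case: ifPn => [/subsetP AX|].
  rewrite -prodr_const [LHS]big_mkcond; apply: eq_bigr => i _.
  by case: ifP => // /AX ->.
case/subsetPn => i iA iX; rewrite (bigD1 i) //= iA (negbTE iX) mul0r //.
Qed.

Lemma ffact_le_expn n k : (n ^_ k <= n ^ k)%N.
Proof.
elim: k => // k IH; rewrite ffactnSr expnSr leq_mul //; exact: leq_subr.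
Qed.

Section RealBounds.

Variable R : realType.

(** The binomial coefficient is at most n^k / k!, and k^k / k! is a single term of the series of
    e^k. *)
Lemma bin_expr_le (n k : nat) :
  (0 < n)%N -> 'C(n, k)%:R * (k%:R / n%:R) ^+ k <= expR k%:R :> R.
Proof.
move=> n0; have nR0 : 0 < n%:R :> R by rewrite ltr0n.
have kk : k%:R ^+ k / k`!%:R <= expR k%:R :> R.
  case: k => [|k]; first by rewrite expr0 fact0 divr1 expR0.
  by apply: le_trans (expR_ge1Dxn k _); rewrite ?ler0n // lerDr.
have f0 : 0 < k`!%:R :> R by rewrite ltr0n fact_gt0.
apply: le_trans kk; rewrite ler_pdivlMr //.
have -> : 'C(n, k)%:R * (k%:R / n%:R) ^+ k * k`!%:R =
          (n ^_ k)%:R / n%:R ^+ k * k%:R ^+ k :> R.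
  by rewrite -bin_ffact natrM expr_div_n; ring.
apply: ler_piMl; first by rewrite exprn_ge0.
by rewrite ler_pdivrMr ?exprn_gt0 // mul1r -natrX ler_nat ffact_le_expn.
Qed.

(** Grouped by size, each of the N + 1 classes contributes at most e^N by [bin_expr_le], and N + 1
    <= e^N. *)
Lemma sum_card_ratio_le (n N : nat) : (0 < n)%N ->
  \sum_(V : {set 'I_n} | (#|V| <= N)%N) (#|V|%:R / n%:R) ^+ #|V|
    <= expR (2 * N%:R) :> R.
Proof.
move=> n0.
rewrite (partition_big (fun V : {set 'I_n} => inord #|V| : 'I_N.+1) xpredT) //=.
apply: (@le_trans _ _ (\sum_(v < N.+1) expR N%:R)); last first.
  rewrite sumr_const card_ord -[leLHS]mulr_natl mulrDl mul1r expRD.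
  apply: ler_wpM2r; first exact: expR_ge0. by rewrite -natr1 addrC expR_ge1Dx.
apply: ler_sum => v _.
apply: (@le_trans _ _ (expR v%:R)); last by rewrite ler_expR ler_nat -ltnS.
apply: le_trans (bin_expr_le v n0).
have -> : 'C(n, v) = #|[set V : {set 'I_n} | #|V| == v]| by rewrite card_draws card_ord.
rewrite mulr_natl -sumr_const.
rewrite [leLHS]big_mkcond [leRHS]big_mkcond; apply: ler_sum => V _; rewrite inE.
case: ifP => [/andP[VN /eqP Vv]|_].
  have -> : #|V| = v by rewrite -Vv inordK.
  by rewrite eqxx.
by case: ifP => // _; rewrite exprn_ge0 // divr_ge0.
Qed.

Variables n m : nat.
Implicit Type A : {set 'I_m * 'I_n}.

(* Tilting: since [|V| <= n], each [A] with at least [|V| + x] edges has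
   [(K/n)^|A| <= (|V|/n)^(|V|+x) (K/|V|)^|A|], and the last factor is summed over
   all subsets of [S * V] by the binomial theorem. *)
Lemma sum_weight_cons_vbls_le (K N : nat) (S : {set 'I_m}) (V : {set 'I_n}) (x : R) :
    0 <= x -> (0 < #|V| <= N)%N ->
  \sum_(A : {set 'I_m * 'I_n} | [&& cons_of A == S, vbls A == V & #|V|%:R + x <= #|A|%:R])
      (K%:R / n%:R) ^+ #|A|
    <= (#|V|%:R / n%:R) ^+ #|V| * ((N%:R / n%:R) `^ x * expR (K * #|S|)%:R).
Proof.
move=> x0 /andP[v0 vN].
have vn : (#|V| <= n)%N by rewrite -[n in (_ <= n)%N]card_ord max_card.
move: v0 vN vn; set v := #|V| => v0 vN vn.
have vR0 : 0 < v%:R :> R by rewrite ltr0n.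
have nR0 : 0 < n%:R :> R by rewrite ltr0n; lia.
have vnR : 0 < (v%:R / n%:R : R) <= 1.
  by rewrite divr_gt0 //= ler_pdivrMr // mul1r ler_nat.
have vnx : (v%:R / n%:R) `^ x <= (N%:R / n%:R) `^ x :> R.
  rewrite ge0_ler_powR // ?nnegrE ?divr_ge0 //.
  by rewrite ler_pM2r ?invr_gt0 // ler_nat.
pose Y : R := (v%:R / n%:R) ^+ v * (N%:R / n%:R) `^ x.
have Y0 : 0 <= Y by rewrite mulr_ge0 ?powR_ge0 ?exprn_ge0 // divr_ge0.
pose W : R := \sum_(A : {set 'I_m * 'I_n} | A \subset setX S V) (K%:R / v%:R) ^+ #|A|.
apply: (@le_trans _ _ (Y * W)).
  rewrite mulr_sumr big_mkcond [leRHS]big_mkcond; apply: ler_sum => A _.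
  case: ifP => [/and3P[/eqP AS /eqP AV xA]|_]; last first.
    by case: ifP => // _; rewrite mulr_ge0 ?exprn_ge0 ?divr_ge0.
  rewrite -AS -AV sub_cons_vbls.
  have -> : K%:R / n%:R = v%:R / n%:R * (K%:R / v%:R) :> R by field; lra.
  rewrite exprMn; apply: ler_wpM2r; first by rewrite exprn_ge0 // divr_ge0.
  apply: (@le_trans _ _ ((v%:R / n%:R) ^+ v * (v%:R / n%:R) `^ x)); last first.
    by apply: ler_wpM2l => //; rewrite exprn_ge0 // divr_ge0.
  case/andP: (vnR) => r0 _; rewrite -!powR_mulrn ?(ltW r0) // -powRD ?(gt_eqF r0) ?implybT //.
  exact: ger_powR.
rewrite mulrA; apply: ler_wpM2l => //.
rewrite /W sum_expr_card_subset cardsX.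
have -> : (K * #|S|)%:R = (#|S| * v)%N%:R * (K%:R / v%:R) :> R.
  by rewrite !natrM; field; lra.
by rewrite expRM_natl lerXn2r ?nnegrE ?expR_ge1Dx ?expR_ge0 // addr_ge0 // divr_ge0.
Qed.

(** The sum is split by constraint set, then by variable set. In the exponent, K comes from the
    edges, 2K from the choice of at most Kc variables, and 1 from bounding binomial(m, c) by e^c
    (m/c)^c. *)
Lemma sum_weight_card_cons_le (K c : nat) (x : R) :
    (0 < n)%N -> (0 < c)%N -> 0 <= x ->
  \sum_(A : {set 'I_m * 'I_n} | [&& #|cons_of A| == c, (#|A| <= K * c)%N
                                   & #|vbls A|%:R + x <= #|A|%:R])
      (K%:R / n%:R) ^+ #|A|
    <= expR ((3 * K%:R + 1) * c%:R) * (m%:R / c%:R) ^+ c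
       * ((K * c)%:R / n%:R) `^ x.
Proof.
move=> n0 c0 x0.
have w0 (A : {set 'I_m * 'I_n}) : 0 <= (K%:R / n%:R : R) ^+ #|A|.
  by rewrite exprn_ge0 // divr_ge0.
pose P (S : {set 'I_m}) := #|S| == c.
pose Q (V : {set 'I_n}) := (0 < #|V| <= K * c)%N.
have AP A : [&& #|cons_of A| == c, (#|A| <= K * c)%N & #|vbls A|%:R + x <= #|A|%:R] ->
    P (cons_of A) && Q (vbls A).
  case/and3P=> Ac AK _; rewrite /P Ac /Q (leq_trans (card_vbls_le A) AK) andbT /=.
  rewrite card_gt0; apply: contraTneq Ac => /eqP; rewrite imset_eq0 => /eqP ->.
  by rewrite /cons_of imset0 cards0 eq_sym -lt0n.
rewrite (partition_big (@cons_of n m) P); last by move=> A /AP /andP[].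
pose Z : R := ((K * c)%:R / n%:R) `^ x * expR (K * c)%:R.
have Z0 : 0 <= Z by rewrite mulr_ge0 ?powR_ge0 ?expR_ge0.
apply: (@le_trans _ _ (\sum_(S | P S) expR (2 * (K * c)%:R) * Z)).
  apply: ler_sum => S /eqP Sc.
  rewrite (partition_big (@vbls n m) Q); last by move=> A /andP[/AP /andP[]].
  apply: le_trans (ler_wpM2r Z0 (sum_card_ratio_le (K * c) n0)).
  rewrite mulr_suml big_mkcond [leRHS]big_mkcond; apply: ler_sum => V _.
  case: ifP => [QV|_]; last first.
    by case: ifP => // _; rewrite mulr_ge0 ?exprn_ge0 ?divr_ge0.
  case/andP: (QV) => _ ->.
  rewrite /Z -[in expR _]Sc.
  apply: le_trans (sum_weight_cons_vbls_le _ _ x0 QV).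
  rewrite big_mkcond [leRHS]big_mkcond; apply: ler_sum => A _.
  case: ifP => [/andP[/andP[/and3P[_ _ xA]] AS AV]|_]; last by case: ifP.
  by move: xA; rewrite AS AV (eqP AV) => ->.
rewrite sumr_const.
have -> : #|P| = 'C(m, c).
  by rewrite -[m in RHS]card_ord -card_draws; apply: eq_card => S; rewrite inE.
(* Without constraints there is no set of c > 0 of them; the other case may divide by [m]. *)
have [m0|m0] := posnP m.
  rewrite m0 bin0n; case: (c) c0 => // c' _; rewrite mulr0n.
  by rewrite !mulr_ge0 ?exprn_ge0 ?divr_ge0 ?powR_ge0 ?expR_ge0.
have cR : 0 < c%:R :> R by rewrite ltr0n.
have mR : 0 < m%:R :> R by rewrite ltr0n.
have binle : 'C(m, c)%:R <= expR c%:R * (m%:R / c%:R) ^+ c :> R.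
  have -> : m%:R / c%:R = (c%:R / m%:R)^-1 :> R by rewrite invf_div.
  rewrite exprVn ler_pdivlMr ?bin_expr_le // exprn_gt0 // divr_gt0 //.
rewrite -[_ *+ _]mulr_natl.
apply: le_trans (ler_wpM2r _ binle) _; first by rewrite mulr_ge0 ?expR_ge0.
have -> : (3 * K%:R + 1) * c%:R = c%:R + (2 * (K * c)%:R + (K * c)%:R) :> R.
  by rewrite natrM; ring.
rewrite !expRD /Z le_eqVlt; apply/orP; left; apply/eqP; ring.
Qed.

Lemma sum_half_pow_le1 (N : nat) : \sum_(k < N) (1 / 2) ^+ k.+1 <= 1 :> R.
Proof.
suff -> : \sum_(k < N) (1 / 2) ^+ k.+1 = 1 - (1 / 2) ^+ N :> R.
  by rewrite gerBl exprn_ge0 // divr_ge0.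
elim: N => [|N IH]; first by rewrite big_ord0 expr0 subrr.
by rewrite big_ord_recr /= IH exprS; field.
Qed.

(** Common shape of the two bad families: [x c] is the excess of edges over variables forced at c
    constraints, and [c0] is the largest number of constraints excluded beforehand (0 for
    implausible, 1 for low-income subgraphs). *)
Definition dense_edge_set (K c0 : nat) (x : nat -> R) (s : R) A : bool :=
  [&& (c0 < #|cons_of A|)%N, #|cons_of A|%:R <= s,
      (#|A| <= K * #|cons_of A|)%N
    & #|vbls A|%:R + x #|cons_of A| <= #|A|%:R].

Lemma sum_weight_dense_le (K c0 : nat) (x : nat -> R) (s B : R) :
    (0 < n)%N -> 0 <= B ->
    (forall c, (c0 < c)%N -> c%:R <= s ->
       0 <= x c /\
       expR ((3 * K%:R + 1) * c%:R) * (m%:R / c%:R) ^+ c * ((K * c)%:R / n%:R) `^ x c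
         <= B * (1 / 2) ^+ (c - c0)) ->
  \sum_(A : {set 'I_m * 'I_n} | dense_edge_set K c0 x s A) (K%:R / n%:R) ^+ #|A| <= B.
Proof.
move=> n0 B0 Bc.
(* Classes are numbered from 0 at the first admissible count c0 + 1; [inord] truncates nothing since
   there are at most [m] constraints. *)
pose k A : 'I_m.+1 := inord (#|cons_of A| - c0.+1).
rewrite (partition_big k xpredT) //=.
apply: le_trans (ler_piMr B0 (sum_half_pow_le1 m.+1)); rewrite mulr_sumr.
apply: ler_sum => j _; pose c := (c0 + j.+1)%N.
have [cs|/negP cs] := boolP (c%:R <= s); last first.
  rewrite big1 ?mulr_ge0 ?exprn_ge0 //; first by rewrite divr_ge0.
  move=> A /andP[/and4P[cA sA _ _] /eqP kA]; case: cs.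
  suff -> : c = #|cons_of A| by [].
  rewrite /c -kA inordK; first by lia.
  by have := max_card (cons_of A); rewrite card_ord; lia.
have c0c : (c0 < c)%N by rewrite /c; lia.
have [xc] := Bc c c0c cs.
have -> : (c - c0)%N = j.+1 by rewrite /c; lia.
apply: le_trans.
apply: le_trans (sum_weight_card_cons_le K n0 (leq_ltn_trans (leq0n _) c0c) xc).
rewrite big_mkcond [leRHS]big_mkcond; apply: ler_sum => A _.
case: ifP => [|_]; last by case: ifP => // _; rewrite exprn_ge0 // divr_ge0.
case/andP=> /and4P[cA sA KA xA] /eqP kA.
have cE : #|cons_of A| = c.
  rewrite /c -kA inordK; first by lia.
  by have := max_card (cons_of A); rewrite card_ord; lia.
by rewrite -cE eqxx KA xA.
Qed.

(** Markov's inequality for the number of sets in [Q] contained in [G], whose expectation is bounded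
    term by term through [card_containing]. *)
Lemma Pr_le_sum_weight (K : nat) (ar : 'I_m -> nat) (E : pred (factor_graph n ar))
    (Q : pred {set 'I_m * 'I_n}) (t : R) :
    (0 < n)%N -> (forall f, (ar f <= K)%N) -> 0 < t ->
    (forall G, E G -> t <= #|[set A : {set 'I_m * 'I_n} | Q A & A \subset edges G]|%:R) ->
  Pr R ar E * t <= \sum_(A : {set 'I_m * 'I_n} | Q A) (K%:R / n%:R) ^+ #|A|.
Proof.
move=> n0 arK t0 Et; rewrite /Pr; set N := #|{: factor_graph n ar}|.
have [->|N0] := posnP N.
  by rewrite invr0 mulr0 mul0r sumr_ge0 // => A _; rewrite exprn_ge0 // divr_ge0.
have NR0 : 0 < N%:R :> R by rewrite ltr0n.
rewrite mulrAC ler_pdivrMr // mulr_suml.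
pose X (G : factor_graph n ar) :=
  #|[set A : {set 'I_m * 'I_n} | Q A & A \subset edges G]|.
apply: (@le_trans _ _ (\sum_G (X G)%:R)).
  rewrite mulr_natl -sumr_const big_mkcond; apply: ler_sum => G _.
  by rewrite inE; case: ifP => // /Et.
apply: (@le_trans _ _ (\sum_(A : {set 'I_m * 'I_n} | Q A) #|containing ar A|%:R)).
  under eq_bigr => G _ do rewrite /X -sum1_card natr_sum.
  rewrite (exchange_big_dep Q) /=; last by move=> G A _; rewrite inE => /andP[].
  apply: ler_sum => A QA; rewrite -sum1_card natr_sum le_eqVlt; apply/orP; left.
  by apply/eqP/eq_bigl => G; rewrite !inE QA.
apply: ler_sum => A _; rewrite expr_div_n mulrAC ler_pdivlMr ?exprn_gt0 ?ltr0n //.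
by rewrite -!natrX -!natrM ler_nat mulnC card_containing.
Qed.

End RealBounds.

(** * Numerical consequences of the choice of gamma *)

Section Estimates.

Variable R : realType.

Lemma expR1_le4 : expR 1 <= 4 :> R.
Proof.
have h : 1 / 2 <= expR (- (1 / 2)) :> R.
  by apply: le_trans (expR_ge1Dx _); lra.
have -> : expR 1 = (expR (- (1 / 2)))^-1 * (expR (- (1 / 2)))^-1 :> R.
  by rewrite -expRN opprK -expRD; congr expR; field.
have h' : (expR (- (1 / 2)))^-1 <= 2 :> R.
  by rewrite -[leRHS]invrK lef_pV2 ?posrE ?expR_gt0 ?invr_gt0 //; lra.
rewrite (_ : 4 = 2 * 2); last by ring.
by rewrite ler_pM ?invr_ge0 ?expR_ge0.
Qed.

Lemma nat_le_expR (k : nat) : k%:R <= expR k%:R :> R.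
Proof. by apply: le_trans (expR_ge1Dx _); rewrite lerDr. Qed.

(** With P = 2^K, e <= 4 gives e^(9K) <= P^18, so the left side is at most beta * beta^29 / P^11.
    The exponent 30 is chosen to absorb these powers of P. *)
Lemma expR_mul_ratio_le (K : nat) (beta : R) :
    (0 < K)%N -> 0 < beta -> beta < 1 / 2 ->
  expR (9 * K%:R) * (2 ^+ K * (beta / 2 ^+ K) ^+ 30) <= beta / 2.
Proof.
move=> K0 b0 b12.
have -> : 9 * K%:R = (9 * K)%N%:R * 1 :> R by rewrite mulr1 natrM.
rewrite expRM_natl.
have e4 : expR 1 ^+ (9 * K) <= (2 ^+ K) ^+ 18 :> R.
  rewrite -exprM (_ : K * 18 = 2 * (9 * K))%N; last by lia.
  rewrite [leRHS]exprM lerXn2r ?nnegrE ?expR_ge0 ?exprn_ge0 //.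
  by apply: le_trans expR1_le4 _; rewrite expr2; lra.
have P2 : 2 <= 2 ^+ K :> R.
  by case: K K0 {e4} => // k _; rewrite exprS ler_peMr // exprn_ege1 //; lra.
move: e4 P2; set P : R := 2 ^+ K => e4 P2.
have P0 : 0 < P by lra.
apply: (@le_trans _ _ (P ^+ 18 * (P * (beta / P) ^+ 30))).
  by apply: ler_wpM2r e4; rewrite mulr_ge0 ?exprn_ge0 ?divr_ge0 //; lra.
have -> : P ^+ 18 * (P * (beta / P) ^+ 30) = beta * (beta ^+ 29 / P ^+ 11).
  by field; lra.
apply: ler_wpM2l; first lra.
rewrite ler_pdivrMr ?exprn_gt0 //.
have b29 : beta ^+ 29 <= 1 by apply: exprn_ile1; lra.
have P10 : 1 <= P ^+ 10 by apply: exprn_ege1; lra.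
rewrite exprS; nra.
Qed.

(** The margin 0.99 yields lambda - zeta >= lambda / 100, whence one constant serves all
    parameters. *)
Lemma exists_exponent_constant :
  exists2 C : R, 0 < C & forall lambda zeta : R,
    zeta <= 99%:R / 100%:R * lambda -> 30 * lambda <= C * ((lambda - zeta) / 2).
Proof. by exists (60 * 100) => [|lambda zeta]; lra. Qed.

(** Put mu = (lambda - zeta) / 2 and r = beta / 2^K. The hypotheses give Kc/n <= 2 r^(C/lambda) /
    Delta^(1/mu). Raising this to the power mu cancels Delta and leaves 2^mu r^(C mu/lambda), where
    mu <= K, C mu/lambda >= 30 and r <= 1. *)
Lemma density_scale_le (K : nat) (lambda zeta beta Delta SMALL C : R) (n c : nat) :
    (0 < K)%N -> 1 <= lambda -> lambda <= K%:R -> 0 < zeta -> zeta < lambda ->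
    30 * lambda <= C * ((lambda - zeta) / 2) ->
    0 < beta -> beta < 1 / 2 -> (0 < n)%N -> 0 < Delta ->
    SMALL <= gamma K lambda beta C * (n%:R / Delta `^ (2 / (lambda - zeta))) ->
    c%:R <= 2 * SMALL ->
  Delta * ((K * c)%:R / n%:R) `^ ((lambda - zeta) / 2)
    <= 2 ^+ K * (beta / 2 ^+ K) ^+ 30.
Proof.
move=> K0 l1 lK z0 zl Cl b0 b12 n0 D0 sS cS.
set mu := (lambda - zeta) / 2.
have mu0 : 0 < mu by rewrite /mu; lra.
have muK : mu <= K%:R by rewrite /mu; lra.
have nR : 0 < n%:R :> R by rewrite ltr0n.
have KR : 0 < K%:R :> R by rewrite ltr0n.
pose r := beta / 2 ^+ K.
have P1 : 1 <= 2 ^+ K :> R by apply: exprn_ege1; lra.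
have r0 : 0 < r by rewrite divr_gt0 //; lra.
have r1 : r <= 1 by rewrite /r ler_pdivrMr; lra.
have rE : beta `^ (1 / lambda) / 2 `^ (K%:R / lambda) = r `^ (1 / lambda).
  rewrite /r powRM ?invr_ge0 ?(ltW b0) //; last by lra.
  congr (_ * _); rewrite -[in RHS]powR_inv1; last by lra.
  rewrite -powR_mulrn // -!powRrM -powRN; congr (_ `^ _); field; lra.
have De : 2 / (lambda - zeta) = mu^-1 by rewrite /mu invf_div.
have Dm0 : 0 < Delta `^ mu^-1 by rewrite powR_gt0.
have Kc : (K * c)%:R / n%:R <= 2 * r `^ (C / lambda) / Delta `^ mu^-1.
  rewrite ler_pdivrMr // natrM.
  have : c%:R <= 2 * (gamma K lambda beta C * (n%:R / Delta `^ mu^-1)).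
    by rewrite -De; lra.
  rewrite /gamma rE -powRrM (_ : 1 / lambda * C = C / lambda); last by field; lra.
  move=> /(ler_wpM2l (ltW KR)) /le_trans; apply.
  by rewrite le_eqVlt; apply/orP; left; apply/eqP; field; rewrite !gt_eqF.
have Kc' : ((K * c)%:R / n%:R) `^ mu <=
    (2 * r `^ (C / lambda) / Delta `^ mu^-1) `^ mu.
  by apply: ge0_ler_powR; rewrite ?(ltW mu0) ?nnegrE ?divr_ge0 ?mulr_ge0 ?powR_ge0.
apply: le_trans (ler_wpM2l (ltW D0) Kc') _.
rewrite powRM ?mulr_ge0 ?invr_ge0 ?powR_ge0 //.
rewrite -[(Delta `^ _)^-1]powRN -powRrM mulNr mulVf ?gt_eqF // powR_inv1 ?(ltW D0) //.
rewrite mulrCA divff ?gt_eqF // mulr1 powRM ?powR_ge0 // -powRrM.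
apply: ler_pM; rewrite ?powR_ge0 //.
  by rewrite -powR_mulrn //; apply: ler_powR => //; lra.
rewrite -powR_mulrn ?(ltW r0) //; apply: ger_powR; first by rewrite r0 r1.
by rewrite mulrAC ler_pdivlMr //; lra.
Qed.

(** * Geometric decay of the terms of the first moment sum *)

Section Terms.

Variables (K n m c : nat) (beta Delta mu : R).
Hypotheses (K2 : (2 <= K)%N) (n0 : (0 < n)%N) (c0 : (0 < c)%N)
  (b0 : 0 < beta) (b12 : beta < 1 / 2) (D0 : 0 < Delta)
  (mDn : m%:R = Delta * n%:R).

Let a : R := (K * c)%:R / n%:R.
Let Q : R := Delta * a `^ mu.

Hypothesis Qle : expR (9 * K%:R) * Q <= beta / 2.

Let nR : 0 < n%:R :> R. Proof. by rewrite ltr0n. Qed.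
Let cR : 0 < c%:R :> R. Proof. by rewrite ltr0n. Qed.
Let KR : 2 <= K%:R :> R. Proof. by rewrite (ler_nat _ 2). Qed.
Let Kc0 : (0 < K * c)%N. Proof. by rewrite muln_gt0 c0 (leq_trans _ K2). Qed.
Let a0 : 0 < a. Proof. by rewrite /a divr_gt0 // ltr0n. Qed.
Let Q0 : 0 <= Q. Proof. by rewrite mulr_ge0 ?powR_ge0 // ltW. Qed.

Let ratio_pow : (m%:R / c%:R) ^+ c * a ^+ c = (K%:R * Delta) ^+ c.
Proof.
by rewrite -exprMn; congr (_ ^+ _); rewrite /a mDn natrM; field; rewrite !gt_eqF.
Qed.

Let half_pow d : (0 < d)%N -> (expR (9 * K%:R) * Q) ^+ d <= beta * (1 / 2) ^+ d.
Proof.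
case: d => // d _; apply: (@le_trans _ _ ((beta / 2) ^+ d.+1)).
  by rewrite lerXn2r ?nnegrE ?mulr_ge0 ?expR_ge0 ?powR_ge0 ?invr_ge0 ?(ltW b0) ?(ltW D0).
rewrite (_ : beta / 2 = beta * (1 / 2)); last by field.
rewrite exprMn; apply: ler_wpM2r; first by rewrite exprn_ge0 // divr_ge0.
by rewrite exprS ler_piMr ?(ltW b0) //; apply: exprn_ile1 (ltW b0) _; have := b12; lra.
Qed.

(** The factor a^c turns (m/c)^c into (K Delta)^c, so the term is the c-th power of e^(3K+1) K Q.
    Then K <= e^K and 4K + 1 <= 9K. *)
Lemma implausible_term_le :
  expR ((3 * K%:R + 1) * c%:R) * (m%:R / c%:R) ^+ c * a `^ (c%:R + mu * c%:R)
    <= beta * (1 / 2) ^+ c.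
Proof.
apply: le_trans (half_pow c0).
rewrite powRD ?(gt_eqF a0) ?implybT // powRrM !powR_mulrn ?powR_ge0 ?(ltW a0) //.
have -> : expR ((3 * K%:R + 1) * c%:R) * (m%:R / c%:R) ^+ c * (a ^+ c * (a `^ mu) ^+ c)
    = expR (3 * K%:R + 1) ^+ c * ((m%:R / c%:R) ^+ c * a ^+ c) * (a `^ mu) ^+ c.
  by rewrite expRM_natr; ring.
rewrite ratio_pow -!exprMn lerXn2r ?nnegrE ?mulr_ge0 ?expR_ge0 ?powR_ge0 ?(ltW D0) //.
rewrite [leLHS](_ : _ = expR (3 * K%:R + 1) * K%:R * Q); last by rewrite /Q !mulrA.
apply: ler_wpM2r => //.
apply: (@le_trans _ _ (expR (3 * K%:R + 1) * expR K%:R)).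
  by rewrite ler_wpM2l ?expR_ge0 ?nat_le_expR.
by rewrite -expRD ler_expR; have := KR; lra.
Qed.

(** Here (K Delta)^c meets only c - 1 factors a^mu, so one Delta is left over. Since a >= 1/n, the
    factor a^(-y) costs at most n^y. The product Delta n^y is exactly the allowed number of
    subgraphs. *)
Lemma low_income_term_le (y : R) : (1 < c)%N -> 0 <= y ->
  expR ((3 * K%:R + 1) * c%:R) * (m%:R / c%:R) ^+ c
      * a `^ (c%:R + mu * (c%:R - 1) - y)
    <= beta * (Delta * n%:R `^ y) * (1 / 2) ^+ (c - 1).
Proof.
move=> c1 y0; set d := (c - 1)%N; have d0 : (0 < d)%N by rewrite subn_gt0.
have cE : c = d.+1 by rewrite /d subn1 prednK.
have cRE : c%:R - 1 = d%:R :> R by rewrite cE -natr1 addrK.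
have Dn0 : 0 <= Delta * n%:R `^ y by rewrite mulr_ge0 ?powR_ge0 ?(ltW D0).
rewrite [leRHS]mulrAC [leRHS]mulrC.
apply: le_trans (ler_wpM2l Dn0 (half_pow d0)).
rewrite cRE powRD ?(gt_eqF a0) ?implybT // powRD ?(gt_eqF a0) ?implybT //.
rewrite powRrM !powR_mulrn ?powR_ge0 ?(ltW a0) //.
have ay : a `^ (- y) <= n%:R `^ y.
  rewrite powRN -powR_inv1 ?powR_ge0 // -powRrM mulrC powRrM powR_inv1 ?(ltW a0) //.
  apply: ge0_ler_powR; rewrite ?nnegrE ?invr_ge0 ?(ltW a0) //.
  rewrite /a invf_div ler_pdivrMr; last by rewrite ltr0n.
  by rewrite ler_peMr // (ler_nat _ 1).
have -> : expR ((3 * K%:R + 1) * c%:R) * (m%:R / c%:R) ^+ c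
          * (a ^+ c * (a `^ mu) ^+ d * a `^ (- y))
    = (expR ((3 * K%:R + 1) * c%:R) * K%:R ^+ c) * (Delta * Q ^+ d) * a `^ (- y).
  transitivity (expR ((3 * K%:R + 1) * c%:R) * ((m%:R / c%:R) ^+ c * a ^+ c)
                * (a `^ mu) ^+ d * a `^ (- y)).
    by ring.
  by rewrite ratio_pow /Q !exprMn [in Delta ^+ c]cE exprS !mulrA.
(* This amounts to (4K + 1)(d + 1) <= 9Kd, with equality at K = 2, d = 1; hence the constant 9. *)
have eK : expR ((3 * K%:R + 1) * c%:R) * K%:R ^+ c <= expR (9 * K%:R) ^+ d :> R.
  apply: (@le_trans _ _ (expR ((3 * K%:R + 1) * c%:R) * expR K%:R ^+ c)).
    by rewrite ler_wpM2l ?expR_ge0 // lerXn2r ?nnegrE ?expR_ge0 ?nat_le_expR.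
  rewrite -!expRM_natr -expRD ler_expR.
  have dR : 1 <= d%:R :> R by rewrite (ler_nat _ 1).
  have : 0 <= (K%:R - 2) * (d%:R - 1) :> R by rewrite mulr_ge0 // subr_ge0.
  by have := KR; rewrite cE -natr1; lra.
rewrite [leRHS](_ : _ = expR (9 * K%:R) ^+ d * (Delta * Q ^+ d) * n%:R `^ y); last first.
  by rewrite exprMn; move: (_ ^+ d) (Q ^+ d) (_ `^ y) => u v w; ring.
have DQ : 0 <= Delta * Q ^+ d by rewrite mulr_ge0 ?exprn_ge0 ?(ltW D0).
apply: ler_pM => //; rewrite ?powR_ge0 ?mulr_ge0 ?expR_ge0 ?exprn_ge0 ?(ltW D0) //.
by apply: ler_wpM2r.
Qed.

End Terms.

End Estimates.

(** * Translation of income into excess, and proof of both bounds *)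

Lemma incomeE (R : realType) (n m tau : nat) (zeta : R) (A : {set 'I_m * 'I_n}) :
  income tau zeta A =
  2 * #|vbls A|%:R + (tau%:R - zeta) * #|cons_of A|%:R - 2 * #|A|%:R.
Proof.
by rewrite /income revenueE rmorphB /= -!pmulrn !natrD !natrM; ring.
Qed.

Lemma income0 (R : realType) (n m tau : nat) (zeta : R) :
  income tau zeta (set0 : {set 'I_m * 'I_n}) = 0.
Proof.
by rewrite incomeE /vbls /cons_of !imset0 !cards0; ring.
Qed.

Theorem theorem4p12 (R : realType) :
  exists C : R, 0 < C /\
    forall (K tau : nat), (3 <= K)%N -> (3 <= tau <= K)%N ->
    let lambda : R := tau%:R - 2 in
    forall zeta beta : R,
      0 < zeta -> zeta <= 99%:R / 100%:R * lambda ->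
      0 < beta -> beta < 1 / 2 ->
    forall (n m : nat) (Delta : R), m%:R = Delta * n%:R ->
    forall ar : 'I_m -> nat, (forall f, (tau - 1 <= ar f <= K)%N) ->
    forall SMALL : R, 1 <= SMALL ->
      SMALL <= gamma K lambda beta C
                 * (n%:R / Delta `^ (2 / (lambda - zeta))) ->
    Pr R ar (fun G : factor_graph n ar =>
               ~~ plausibility_assumption tau zeta SMALL G) <= beta
    /\
    (zeta < 1 ->
     Pr R ar (fun G : factor_graph n ar =>
               ~~ (#|low_income_subgraphs tau zeta SMALL G|%:R
                     <= Delta * n%:R `^ ((1 + zeta) / 2))) <= beta).
Proof.
have [C C0 CP] := exists_exponent_constant R; exists C; split=> //.
move=> K tau K3 /andP[t3 tK] lambda zeta beta z0 zl b0 b12 n m Delta mDn ar arK SMALL S1 sS.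
have l1 : 1 <= lambda by rewrite /lambda; have : (3 : R) <= tau%:R; [rewrite (ler_nat _ 3)|lra].
have lK : lambda <= K%:R by rewrite /lambda; have : tau%:R <= K%:R :> R; [rewrite ler_nat|lra].
have zl' : zeta < lambda by lra.
(* For n = 0 the upper bound on [SMALL] would be 0, against 1 <= SMALL. *)
have n0 : (0 < n)%N.
  case: posnP => // n0; move: sS; rewrite n0 mul0r mulr0; lra.
have nR : 0 < n%:R :> R by rewrite ltr0n.
have D0 : 0 < Delta.
  have : 0 <= Delta by rewrite -(pmulr_lge0 _ nR) -mDn.
  (* Delta = 0 is excluded in the same way: its positive power is 0, whose inverse is 0 by
     convention, so the bound on [SMALL] would again be 0. *)
  rewrite le_eqVlt => /orP[/eqP D0|//]; move: sS; rewrite -D0 powR0; last first.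
    by rewrite gt_eqF // divr_gt0 //; lra.
  by rewrite invr0 !mulr0; lra.
have K0 : (0 < K)%N by apply: leq_trans K3.
have K2 : (2 <= K)%N by apply: leq_trans K3.
have arK' f : (ar f <= K)%N by case/andP: (arK f).
pose mu := (lambda - zeta) / 2.
have Qle c : c%:R <= 2 * SMALL ->
    expR (9 * K%:R) * (Delta * ((K * c)%:R / n%:R) `^ mu) <= beta / 2.
  move=> cS; apply: le_trans (expR_mul_ratio_le K0 b0 b12).
  by rewrite ler_wpM2l ?expR_ge0 // (density_scale_le K0 l1 lK z0 zl' (CP _ _ zl) b0 b12 n0 D0 sS).
split=> [|z1].
  (* Negative income means |A| > |vbls| + c (tau - zeta) / 2, and (tau - zeta) / 2 = 1 + mu. Markov
     at threshold 1 is the union bound. *)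
  pose x c : R := c%:R + mu * c%:R.
  rewrite -[leLHS]mulr1.
  apply: le_trans (Pr_le_sum_weight (Q := dense_edge_set K 0 x (2 * SMALL)) n0 arK' ltr01 _) _.
    move=> G /forallPn[A]; rewrite negb_imply => /andP[/andP[/andP[AG _] cS]].
    rewrite -ltNge => I0; rewrite (ler_nat _ 1); apply/card_gt0P; exists A; rewrite inE AG andbT.
    apply/and4P; split=> //.
    - rewrite lt0n cons_of_eq0; apply: contraTneq I0 => ->.
      by rewrite income0 ltxx.
    - exact: card_le_mul_cons arK' AG.
    - by move: I0; rewrite incomeE /x /mu /lambda; lra.
  apply: sum_weight_dense_le => // [|c c0 cS]; first exact: ltW.
  split; first by rewrite /x addr_ge0 // mulr_ge0 // /mu; lra.
  rewrite subn0; exact: implausible_term_le (Qle _ cS).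
pose y := (1 + zeta) / 2.
(* Income at most tau - 1 forces an excess of (1 + mu) c - (tau - 1) / 2, and (tau - 1) / 2 = mu +
   y. *)
pose x c : R := c%:R + mu * (c%:R - 1) - y.
have t0 : 0 < Delta * n%:R `^ y by rewrite mulr_gt0 ?powR_gt0.
rewrite -(ler_pM2r t0).
apply: le_trans (Pr_le_sum_weight (Q := dense_edge_set K 1 x (2 * SMALL)) n0 arK' t0 _) _.
  move=> G; rewrite -ltNge => /ltW/le_trans; apply; rewrite ler_nat.
  apply/subset_leq_card/subsetP=> A; rewrite !inE => /and4P[A0 /andP[AG /forall_inP tA] cS IA].
  rewrite AG andbT; apply/and4P; split=> //.
  (* A star has income tau - zeta, which exceeds tau - 1 because zeta < 1, so at least two
     constraints occur. *)
  - rewrite ltn_neqAle lt0n cons_of_eq0 A0 andbT eq_sym; apply: contraTneq IA => c1.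
    by rewrite incomeE c1 card_vbls_cons1 // -ltNge; lra.
  - exact: card_le_mul_cons arK' AG.
  - by move: IA; rewrite incomeE /x /y /mu /lambda; lra.
apply: sum_weight_dense_le => // [|c c1 cS]; first by rewrite mulr_ge0 ?(ltW b0) ?(ltW t0).
have cR : 2 <= c%:R :> R by rewrite (ler_nat _ 2).
split; first by rewrite /x /y /mu; nra.
apply: low_income_term_le => //; [exact: ltnW|exact: Qle|rewrite /y; lra].
Qed.
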